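(* $\mathrm{FO}_{\mathrm{bit}}(Q^{\mathrm{un}}_{\mathrm{Grp}})$ is not contained in $\mathrm{FO}(Q^{\mathrm{un}}_{\mathrm{Grp}})$.
   Context: Words over a finite ordered alphabet are viewed as finite structures with universe $\{1,\dots,n\}$, unary letter predicates $P_a$, linear order $<$, equality, constants min, max; FO is first-order logic over this signature, and $\mathrm{FO}_{\mathrm{bit}}$ additionally allows $\mathrm{BIT}(x,y)$, true iff the $x$th bit of the binary representation of $y$ is 1. Unary Lindström quantifier: for a language $L$ over ordered alphabet $(b_1,\dots,b_t)$ and formulas $\phi_1(x),\dots,\phi_{t-1}(x)$ (possibly with other free variables), $Q_L x[\phi_1,\dots,\phi_{t-1}]$ holds on $w$ of length $n$ iff the word of length $n$ whose $i$th letter is $b_j$ for the least $j$ with $\phi_j$ true at $x=i$, and $b_t$ if none, belongs to $L$. A groupoid is a finite set $G$ with an arbitrary binary operation; $\mathcal W(S,G)$, $S\subseteq G$, is the set of nonempty words over alphabet $G$ evaluating into $S$ under some legal bracketing. $\mathrm{FO}(Q^{\mathrm{un}}_{\mathrm{Grp}})$ (resp. $\mathrm{FO}_{\mathrm{bit}}(Q^{\mathrm{un}}_{\mathrm{Grp}})$) is the class of languages definable in FO (resp. $\mathrm{FO}_{\mathrm{bit}}$) extended by unary quantifiers $Q_L$ with $L=\mathcal W(S,G)$ for finite groupoids $G$, $S\subseteq G$, arbitrarily nested. *)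

(* Defs.v *)
From mathcomp Require Import all_boot.

Set Implicit Arguments.
Unset Strict Implicit.
Unset Printing Implicit Defensive.

(* Structures have a nonempty universe (min and
   max denote), so only nonempty words matter: membership of [::] in a language
   is never consulted by [sat] or [definable]. *)
Definition language (A : finType) := seq A -> Prop.

Definition language_class := forall A : finType, language A -> Prop.

Definition contained (C D : language_class) : Prop :=
  forall (A : finType) (L : language A), C A L -> D A L.

Inductive term (k : nat) : Type :=
| Var : 'I_k -> term k
| Min : term k
| Max : term k.

(* Formulas over words on the alphabet A, with k free variables in de Bruijn
   style: a binder introduces the index 0. BIT atoms exist only if [bit] holds.
   In [Qun], b enumerates the ordered alphabet (b_1, ..., b_t.+1) of a language L
   in the class K, and all t formulas share the bound variable. *)
Inductive form (A : finType) (bit : bool) (K : language_class) (k : nat)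
    : Type :=
| Letter : A -> term k -> form A bit K k
| Lt : term k -> term k -> form A bit K k
| Eq : term k -> term k -> form A bit K k
| Bit : bit -> term k -> term k -> form A bit K k
| Not : form A bit K k -> form A bit K k
| And : form A bit K k -> form A bit K k -> form A bit K k
| Or : form A bit K k -> form A bit K k -> form A bit K k
| Ex : form A bit K k.+1 -> form A bit K k
| All : form A bit K k.+1 -> form A bit K k
| Qun : forall (T : finType) (L : language T) (t : nat) (b : 'I_t.+1 -> T),
    K T L -> bijective b -> ('I_t -> form A bit K k.+1) -> form A bit K k.

(* Positions 1, ..., n.+1 are represented by 'I_n.+1, shifted down by one. *)
Definition eval_term (n k : nat) (e : k.-tuple 'I_n.+1) (u : term k)
    : 'I_n.+1 :=
  match u with
  | Var i => tnth e i
  | Min => ord0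
  | Max => ord_max
  end.

(* Bits are counted from 1, starting with the least significant one. *)
Definition BIT (x y : nat) : bool := odd (y %/ 2 ^ x.-1).

Definition selects (T : Type) (t : nat) (b : 'I_t.+1 -> T) (P : 'I_t -> Prop)
    (c : T) : Prop :=
  (exists j : 'I_t, [/\ P j, forall i : 'I_t, i < j -> ~ P i
                      & c = b (widen_ord (leqnSn t) j)])
  \/ ((forall j : 'I_t, ~ P j) /\ c = b ord_max).

Fixpoint sat (A : finType) (bit : bool) (K : language_class) (n : nat)
    (w : n.+1.-tuple A) (k : nat) (phi : form A bit K k)
    (e : k.-tuple 'I_n.+1) {struct phi} : Prop :=
  match phi with
  | Letter a u => tnth w (eval_term e u) = a
  | Lt u v => eval_term e u < eval_term e v
  | Eq u v => eval_term e u = eval_term e v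
  | Bit _ u v => BIT (eval_term e u).+1 (eval_term e v).+1
  | Not f => ~ sat w f e
  | And f g => sat w f e /\ sat w g e
  | Or f g => sat w f e \/ sat w g e
  | Ex f => exists x : 'I_n.+1, sat w f [tuple of x :: e]
  | All f => forall x : 'I_n.+1, sat w f [tuple of x :: e]
  | @Qun _ _ _ _ T L t b _ _ f =>
      exists v : n.+1.-tuple T,
        (forall x : 'I_n.+1,
           selects b (fun j => sat w (f j) [tuple of x :: e]) (tnth v x))
        /\ L v
  end.

Definition definable (bit : bool) (K : language_class) : language_class :=
  fun A L => exists phi : form A bit K 0,
    forall (n : nat) (w : n.+1.-tuple A), L w <-> sat w phi [tuple].

Inductive evaluates (G : Type) (op : G -> G -> G) : seq G -> G -> Prop :=
| evaluates_letter (g : G) : evaluates op [:: g] g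
| evaluates_op (u v : seq G) (g h : G) :
    evaluates op u g -> evaluates op v h -> evaluates op (u ++ v) (op g h).

Definition word_problem (G : finType) (op : G -> G -> G) (S : {set G})
    : language G :=
  fun w => exists2 g, g \in S & evaluates op w g.

Definition Grp : language_class := fun G L =>
  exists (op : G -> G -> G) (S : {set G}),
    forall w : seq G, L w <-> word_problem op S w.

Definition FO_Grp : language_class := definable false Grp.

Definition FObit_Grp : language_class := definable true Grp.

(* Main.v *)
Require Import Defs.
From mathcomp Require Import all_boot.
From mathcomp Require Import all_order all_algebra zify.
From Stdlib Require Import FunctionalExtensionality.

(** Over a one-letter alphabet a word is just its length, and every formula of
    FO with unary groupoidal quantifiers defines a Presburger relation between
    the length and the values of its free variables. Only the quantifiers need
    an argument: the word they read is piecewise periodic, with boundaries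
    depending linearly on the parameters, and by Parikh's theorem for the
    grammar which brackets the runs of a finite graph, the segment lengths for
    which such a word evaluates into [S] form a Presburger set. Hence
    bit-free formulas define ultimately periodic sets of lengths. With BIT one
    can say that the length has a single binary digit 1, i.e. is a power of two.

    Presburger relations are handled semantically, as those invariant under some
    [eqv D]; the back-and-forth property of these equivalences takes the place
    of quantifier elimination. *)

Set Implicit Arguments.
Unset Strict Implicit.
Unset Printing Implicit Defensive.

Import Order.TTheory GRing.Theory Num.Theory.

Local Open Scope ring_scope.
Local Open Scope nat_scope.

Definition env := nat -> nat.

Definition scons (y : nat) (x : env) : env := fun i => if i is j.+1 then x j else y.

(** * Linear forms *)

Section LinearForms.
Local Open Scope ring_scope.

(** One number bounds the variables used, the coefficients and the constant, so that each [D] admits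
    only finitely many forms up to extensional equality. *)
Definition lin (D : nat) (f : env -> int) : Prop :=
  exists (a : nat -> int) (c : int),
    [/\ forall i, `|a i| <= D%:Z, `|c| <= D%:Z
      & forall x, f x = c + \sum_(i < D) a i * (x i)%:Z].

Lemma sum_widen D E (F : nat -> int) : (D <= E)%N ->
  \sum_(i < D) F i = \sum_(i < E) (if (i < D)%N then F i else 0).
Proof. by move=> leDE; rewrite (big_ord_widen _ F leDE) big_mkcond. Qed.

Lemma lin_mono D E f : (D <= E)%N -> lin D f -> lin E f.
Proof.
move=> leDE [a [c [ha hc hf]]].
exists (fun i => if (i < D)%N then a i else 0), c; split; try lia.
  by move=> i; have := ha i; case: ifP; lia.
move=> x; rewrite hf; congr (_ + _).
rewrite (sum_widen (fun i => a i * (x i)%:Z) leDE).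
by apply: eq_bigr => i _; case: ifP; rewrite ?mul0r.
Qed.

Lemma eq_lin D f g : f =1 g -> lin D f -> lin D g.
Proof. by move=> fg [a [c [ha hc hf]]]; exists a, c; split=> // x; rewrite -fg. Qed.

Lemma lin_add D E f g : lin D f -> lin E g -> lin (D + E) (fun x => f x + g x).
Proof.
move=> [a [c [ha hc hf]]] [b [d [hb hd hg]]].
exists (fun i => (if (i < D)%N then a i else 0) + (if (i < E)%N then b i else 0)), (c + d).
split; [move=> i; have := ha i; have := hb i; do 2! case: ifP; lia | lia |].
move=> x; rewrite hf hg addrACA; congr (_ + _).
rewrite (sum_widen (fun i => a i * (x i)%:Z) (leq_addr E D)).
rewrite (sum_widen (fun i => b i * (x i)%:Z) (leq_addl D E)).
rewrite -big_split /=; apply: eq_bigr => i _.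
by do 2! case: ifP => _; rewrite mulrDl ?mul0r.
Qed.

Lemma lin_scale D f (z : int) : lin D f -> lin (`|z| * D)%N (fun x => z * f x).
Proof.
case: (z =P 0) => [-> _|/eqP z0].
  exists (fun=> 0), 0; split=> // x.
  by rewrite absz0 mul0n big_ord0 mul0r addr0.
have leD : (D <= `|z| * D)%N by rewrite leq_pmull // absz_gt0.
move=> [a [c [ha hc hf]]].
exists (fun i => if (i < D)%N then z * a i else 0), (z * c); split.
- move=> i; case: ifP => _; last by lia.
  by rewrite normrM; have := ha i; rewrite PoszM abszE; apply: ler_wpM2l; lia.
- by rewrite normrM PoszM abszE; apply: ler_wpM2l; lia.
- move=> x; rewrite hf mulrDr mulr_sumr; congr (_ + _).
  rewrite (sum_widen (fun i => z * (a i * (x i)%:Z)) leD).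
  by apply: eq_bigr => i _; case: ifP => _; rewrite ?mul0r ?mulrA.
Qed.

Lemma lin_const (c : int) : lin `|c|%N (fun=> c).
Proof.
exists (fun=> 0), c; split=> [i||x]; [by lia | by lia |].
by rewrite big1 ?addr0 // => i _; rewrite mul0r.
Qed.

Lemma lin_var i : lin i.+1 (fun x => (x i)%:Z).
Proof.
exists (fun j => (j == i)%:Z), 0; split=> [j||x]; [by case: eqP|by []|].
rewrite add0r (bigD1 ord_max) //= eqxx mul1r big1 ?addr0 // => j.
by rewrite -val_eqE /= => /negbTE ->; rewrite mul0r.
Qed.

Lemma lin_sum n (D : nat -> nat) (f : nat -> env -> int) :
  (forall i, lin (D i) (f i)) -> lin (\sum_(i < n) D i)%N (fun x => \sum_(i < n) f i x).
Proof.
move=> h; elim: n => [|n IH].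
  rewrite big_ord0; apply: eq_lin (lin_const 0) => x; by rewrite big_ord0.
rewrite big_ord_recr; apply: eq_lin (lin_add IH (h n)) => x.
by rewrite big_ord_recr.
Qed.

(** [E] is fixed before [f]: invariance under renaming needs one bound for all forms of size [D] at
    once. *)
Lemma lin_rename D (r : nat -> nat) : exists E, forall f,
  lin D f -> lin E (fun x => f (fun i => x (r i))).
Proof.
exists (D + \sum_(i < D) D * (r i).+1)%N => f [a [c [ha hc hf]]].
apply: (@eq_lin _ (fun x => c + \sum_(i < D) a i * (x (r i))%:Z)) => [x|].
  by rewrite hf.
apply: lin_add; first by apply: lin_mono (lin_const c); lia.
apply: (@lin_sum _ (fun i => D * (r i).+1)%N (fun i x => a i * (x (r i))%:Z)) => i.
apply: lin_mono (lin_scale (a i) (lin_var (r i))).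
by have := ha i; rewrite leq_mul2r; lia.
Qed.

Lemma lin_scons D f : lin D f -> exists (b : int) g,
  [/\ `|b| <= D%:Z, lin D g & forall y x, f (scons y x) = b * y%:Z + g x].
Proof.
case: D => [|D] [a [c [ha hc hf]]].
  exists 0, f; split=> // [|y x]; first by exists a, c.
  by rewrite mul0r add0r !hf !big_ord0.
exists (a 0%N), (fun x => c + \sum_(i < D) a i.+1 * (x i)%:Z); split=> // [|y x].
  exists (fun i => if (i < D)%N then a i.+1 else 0), c; split=> // [i|x].
    by case: ifP => // _; rewrite normr0.
  rewrite big_ord_recr /= ltnn mul0r addr0; congr (_ + _).
  by apply: eq_bigr => i _; rewrite ltn_ord.
rewrite hf big_ord_recl /= addrCA; congr (_ + (_ + _)).
Qed.

Lemma lin_finite D : exists (I : finType) (F : I -> env -> int),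
  (forall i, lin D (F i)) /\ forall f, lin D f -> exists i, F i =1 f.
Proof.
(* Coefficients are coded by [0, ..., 2 * D] and shifted down by [D]; the index [ord_max] carries
   the constant. *)
pose co (j : 'I_(D.*2).+1) : int := j%:Z - D%:Z.
exists ({ffun 'I_D.+1 -> 'I_(D.*2).+1}),
  (fun (F : {ffun _}) (x : env) => co (F ord_max) + \sum_(i < D) co (F (inord i)) * (x i)%:Z); split.
  have hco (j : 'I_(D.*2).+1) : `|co j| <= D%:Z by rewrite /co; have := ltn_ord j; lia.
  by move=> F; exists (fun i => co (F (inord i))), (co (F ord_max)); split.
move=> f [a [c [ha hc hf]]].
have coK (z : int) : `|z| <= D%:Z -> co (inord (absz (z + D%:Z))) = z.
  by move=> hz; rewrite /co inordK; lia.
exists [ffun i : 'I_D.+1 => if i == ord_max then inord (absz (c + D%:Z))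
                            else inord (absz (a i + D%:Z))] => x.
rewrite hf ffunE eqxx coK //; congr (_ + _); apply: eq_bigr => i _.
rewrite ffunE -val_eqE /= inordK; last by have := ltn_ord i; lia.
by rewrite ltn_eqF ?ltn_ord // coK.
Qed.

Lemma lin_modn D M f x x' : lin D f -> (forall i, (i < D)%N -> x i = x' i %[mod M]) ->
  (f x = f x' %[mod M])%Z.
Proof.
move=> [a [c [_ _ hf]]] hx; rewrite !hf.
apply/eqP; rewrite eqz_mod_dvd opprD addrACA subrr add0r -sumrB.
apply: rpred_sum => i _; rewrite -mulrBr; apply: dvdz_mull.
by rewrite -eqz_mod_dvd; apply/eqP; have := hx i (ltn_ord i); lia.
Qed.

End LinearForms.

(** * Presburger relations *)

(** No congruence or linear inequality of size [D] separates [x] from [x']. The factorial is a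
    multiple of every positive number up to [D], and factorials divide one another, so the relation
    gets finer as [D] grows. *)
Definition eqv (D : nat) (x x' : env) : Prop :=
  (forall i, i < D -> x i = x' i %[mod D`!]) /\
  (forall f, lin D f -> (0 <= f x)%R = (0 <= f x')%R).

Lemma eqv_sym D x x' : eqv D x x' -> eqv D x' x.
Proof. by case=> h1 h2; split=> [i /h1|f /h2] ->. Qed.

Lemma fact_dvd m n : m <= n -> m`! %| n`!.
Proof. by move=> lemn; rewrite -(bin_fact lemn) dvdn_mull // dvdn_mulr. Qed.

Lemma modn_dvd d m a b : d %| m -> a = b %[mod m] -> a = b %[mod d].
Proof. by move=> dm h; rewrite -(modn_dvdm a dm) h modn_dvdm. Qed.

Lemma eqv_mono D E x x' : D <= E -> eqv E x x' -> eqv D x x'.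
Proof.
move=> leDE [h1 h2]; split=> [i ltiD|f /(lin_mono leDE)/h2//].
by apply: (modn_dvd (fact_dvd leDE)); apply: h1; apply: leq_trans leDE.
Qed.

(** Bounds a form of size [D] scaled by a divisor of the factorial; the summand 1 pays for turning a
    strict inequality into a weak one. *)
Definition thr D := D`! * D + 1.

(* [y] enters a form of size [D] with a coefficient [b] dividing [D`!], so
   scaling turns each constraint into a comparison of [D`! * y] with a form in
   the remaining variables. *)
Lemma eqv_scons D x x' y y' : eqv D x x' -> y = y' %[mod D`!] ->
  (forall t, lin (thr D) t ->
    (t x <= (D`! * y)%:Z)%R = (t x' <= (D`! * y')%:Z)%R) ->
  eqv D (scons y x) (scons y' x').
Proof.
move=> [h1 h2] hy ht; split=> [[|i] ltiD|f lf] //=; first exact/h1/ltnW.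
have [b [g [hb lg fE]]] := lin_scons lf; rewrite !fE.
case: (ltrgt0P b) => b0.
- have : (`|b| %| D`!)%N by rewrite dvdn_fact; lia.
  case/dvdnP=> q qE; have q0 : 0 < q by have := fact_gt0 D; rewrite qE; lia.
  have := ht (fun x => - q%:Z * g x)%R.
  have lq : lin (thr D) (fun x => - q%:Z * g x)%R.
    apply: lin_mono (lin_scale (- q%:Z)%R lg).
    rewrite /thr abszN absz_nat (leq_trans _ (leq_addr _ _)) // leq_mul2r.
    by rewrite qE; nia.
  have bE : b = (`|b|%N : int) by lia.
  move=> /(_ lq); rewrite qE bE absz_nat => E.
  have aux (z : int) (u : nat) : (0 <= `|b|%N%:Z * u%:Z + z)%R =
    (- q%:Z * z <= (q * `|b|%N * u)%N%:Z)%R.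
    have -> : (- q%:Z * z <= (q * `|b|%N * u)%N%:Z)%R =
      (0 <= q%:Z * (`|b|%N%:Z * u%:Z + z))%R by rewrite mulrDr; lia.
    by rewrite pmulr_rge0 //; lia.
  by rewrite !aux.
- have : (`|b| %| D`!)%N by rewrite dvdn_fact; lia.
  case/dvdnP=> q qE; have q0 : 0 < q by have := fact_gt0 D; rewrite qE; lia.
  (* For negative [b] the constraint reads [D! * y <= q * g x], which is the negation of
     [q * g x + 1 <= D! * y]. *)
  have := ht (fun x => q%:Z * g x + 1)%R.
  have lq : lin (thr D) (fun x => q%:Z * g x + 1)%R.
    apply: lin_mono (lin_add (lin_scale q%:Z%R lg) (lin_const 1%R)).
    by rewrite /thr absz_nat leq_add2r leq_mul2r qE; nia.
  have bE : b = (- (`|b|%N : int))%R by lia.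
  move=> /(_ lq); rewrite qE => E.
  have aux (z : int) (u : nat) : (0 <= b * u%:Z + z)%R =
    ~~ (q%:Z * z + 1 <= (q * `|b|%N * u)%N%:Z)%R.
    have -> : (q%:Z * z + 1 <= (q * `|b|%N * u)%N%:Z)%R =
      ~~ (0 <= q%:Z * (b * u%:Z + z))%R by rewrite {2}bE mulrDr; lia.
    by rewrite negbK pmulr_rge0 //; lia.
  by rewrite !aux E.
- by rewrite b0 !mul0r !add0r; apply: h2.
Qed.

(* With [t] the largest threshold below [D`! * y], the witness is built from
   the value of [t] at [x'] and the residue of [D`! * y - t] modulo [D`! ^ 2]. *)
Lemma eqv_forth D : exists E, forall x x', eqv E x x' ->
  forall y, exists y', eqv D (scons y x) (scons y' x').
Proof.
have [L defL] : exists L, D`! = L by exists D`!.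
have L0 : 0 < L by rewrite -defL fact_gt0.
(* Room for the difference of two thresholds plus an offset below [L * L], and for [L * L] to divide
   the factorial of [E]. *)
pose E := thr D + thr D + L * L.
have DE : D <= E by rewrite /E /thr defL; nia.
exists E => x x' xx' y.
have [I [F [linF FP]]] := lin_finite (thr D).
(* The zero form lies below [L * y], so the maximum is taken over a nonempty set. *)
have lin0 : lin (thr D) (fun=> 0%R) by apply: lin_mono (lin_const 0%R).
have [i0 F0] := FP _ lin0.
have hi0 : (F i0 x <= (L * y)%:Z)%R by rewrite F0.
pose i := [arg max_(i > i0 | (F i x <= (L * y)%:Z)%R) F i x]%O.
have [ti tmax] : (F i x <= (L * y)%:Z)%R /\
    forall j, (F j x <= (L * y)%:Z)%R -> (F j x <= F i x)%R.
  by rewrite /i; case: arg_maxP.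
set t := F i x in ti tmax.
have t0 : (0 <= t)%R by rewrite -(F0 x); apply: tmax.
(* The square is the right modulus: [y] and [y'] agree modulo [L] exactly when [L * y] and [L * y']
   agree modulo [L * L]. *)
have LLE : L * L %| E`! by apply: dvdn_fact; rewrite /E; nia.
have xmod j : j < E -> x j = x' j %[mod L * L].
  by move=> hj; apply: modn_dvd LLE _; apply: xx'.1.
have t'0 : (0 <= F i x')%R.
  by rewrite -xx'.2 //; apply: lin_mono (linF i); rewrite /E; lia.
have tt' : (t = F i x' %[mod (L * L)%N])%Z.
  by apply: lin_modn (linF i) _ => j hj; apply: xmod; rewrite /E; lia.
have [a tE] : exists a : nat, t = a%:Z by exists `|t|%N; rewrite gez0_abs.
have [a' tE'] : exists a : nat, F i x' = a%:Z by exists `|F i x'|%N; rewrite gez0_abs.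
have aL : a <= L * y by move: ti; rewrite tE; lia.
pose d := (L * y - a) %% (L * L).
have dle : d <= L * y - a by apply: leq_mod.
have aa' : a = a' %[mod L * L] by move: tt'; rewrite tE tE' !modz_nat => -[].
have adE : a + d = L * y %[mod L * L] by rewrite modnDmr subnKC.
have : L %| a' + d.
  rewrite /dvdn -(modn_dvdm _ (dvdn_mulr L (dvdnn L))) -modnDml -aa' modnDml adE.
  by rewrite modn_dvdm ?dvdn_mulr // modnMr.
case/dvdnP=> y' y'E; exists y'.
apply: eqv_scons => [||f lf]; first exact: eqv_mono xx'.
  rewrite defL.
  have : L * y' = L * y %[mod L * L].
    by rewrite mulnC -y'E -modnDml -aa' modnDml.
  by rewrite -!muln_modr => /eqP; rewrite eqn_pmul2l // => /eqP.
have [j fE] := FP f lf; rewrite -!fE defL.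
(* Every threshold up to [L * y] is at most [t], and [t <= t + d <= L * y]; so [L * y] may be
   replaced by [t + d], whose counterpart at [x'] is exactly [L * y']. *)
have -> : (F j x <= (L * y)%:Z)%R = (0 <= t + d%:Z - F j x)%R.
  have := tmax j; clearbody t d; clear -tE dle aL; move: (F j x) => u tj.
  by apply/idP/idP => [/tj|]; lia.
have -> : (F j x' <= (L * y')%:Z)%R = (0 <= F i x' + d%:Z - F j x')%R.
  by rewrite mulnC -y'E tE' PoszD subr_ge0.
have lind : lin E (fun x => F i x + d%:Z - F j x)%R.
  have := lin_add (lin_add (linF i) (lin_const d%:Z)) (lin_scale (-1)%R (linF j)).
  move/(lin_mono (E := E)) => h; apply: eq_lin (h _) => [z|]; first by rewrite mulN1r.
  have : d < L * L by rewrite ltn_mod muln_gt0 L0.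
  by clearbody d; rewrite /E; clear; lia.
exact: xx'.2 _ lind.
Qed.

(** * Closure properties of Presburger relations *)

Definition presburger (R : env -> Prop) : Prop :=
  exists D, forall x x', eqv D x x' -> R x -> R x'.

Lemma presburger_ext R R' :
  (forall x, R x <-> R' x) -> presburger R -> presburger R'.
Proof. by move=> RR' [D h]; exists D => x x' /h xx' /RR'/xx'/RR'. Qed.

Lemma presburger_const (P : Prop) : presburger (fun=> P).
Proof. by exists 0. Qed.

Lemma presburger_not R : presburger R -> presburger (fun x => ~ R x).
Proof. by move=> [D h]; exists D => x x' /eqv_sym/h xx' nR /xx'. Qed.

Lemma presburger_and R R' : presburger R -> presburger R' ->
  presburger (fun x => R x /\ R' x).
Proof.
move=> [D h] [D' h']; exists (maxn D D') => x x' xx' [r r']; split.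
  by apply: h r; apply: eqv_mono xx'; apply: leq_maxl.
by apply: h' r'; apply: eqv_mono xx'; apply: leq_maxr.
Qed.

Lemma presburger_or R R' : presburger R -> presburger R' ->
  presburger (fun x => R x \/ R' x).
Proof.
move=> [D h] [D' h']; exists (maxn D D') => x x' xx' [r|r']; [left|right].
  by apply: h r; apply: eqv_mono xx'; apply: leq_maxl.
by apply: h' r'; apply: eqv_mono xx'; apply: leq_maxr.
Qed.

Lemma presburger_uniform (I : finType) (R : I -> env -> Prop) :
  (forall i, presburger (R i)) ->
  exists D, forall i x x', eqv D x x' -> R i x -> R i x'.
Proof.
move=> h; have [D hD] : exists D : I -> nat, forall i x x', eqv (D i) x x' -> R i x -> R i x'.
  (* Building the bounds along a list avoids an appeal to choice. *)
  have : forall s : seq I, exists D : I -> nat, forall i, i \in s ->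
      forall x x', eqv (D i) x x' -> R i x -> R i x'.
    elim=> [|i s [D hD]]; first by exists (fun=> 0).
    have [d hd] := h i; exists (fun j => if j == i then d else D j) => j.
    by rewrite inE; case: eqP => [-> _|_ /=]; [exact: hd|exact: hD].
  by case/(_ (enum I)) => D hD; exists D => i; apply: hD; rewrite mem_enum.
exists (\max_i D i) => i x x' xx'; apply: hD; apply: eqv_mono xx'.
exact: leq_bigmax.
Qed.

Lemma presburger_all_fin (I : finType) (R : I -> env -> Prop) :
  (forall i, presburger (R i)) -> presburger (fun x => forall i, R i x).
Proof.
by move=> /presburger_uniform[D h]; exists D => x x' /h xx' r i; apply: xx'.
Qed.

Lemma presburger_ex_fin (I : finType) (R : I -> env -> Prop) :
  (forall i, presburger (R i)) -> presburger (fun x => exists i, R i x).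
Proof.
move=> /presburger_uniform[D h]; exists D => x x' /h xx' [i r]; exists i.
exact: xx'.
Qed.

Lemma presburger_imp R R' : presburger R -> presburger R' ->
  presburger (fun x => R x -> R' x).
Proof.
move=> [D h] [D' h']; exists (maxn D D') => x x' xx' rr' r'.
apply: h' (rr' _); first by apply: eqv_mono xx'; apply: leq_maxr.
by apply: h r'; apply: eqv_mono (eqv_sym xx'); apply: leq_maxl.
Qed.

Lemma presburger_ex R : presburger R ->
  presburger (fun x => exists y, R (scons y x)).
Proof.
move=> [D h]; have [E hE] := eqv_forth D; exists E => x x' /hE xx' [y r].
by have [y' yy'] := xx' y; exists y'; apply: h r.
Qed.

Lemma presburger_all R : presburger R ->
  presburger (fun x => forall y, R (scons y x)).
Proof.
move=> [D h]; have [E hE] := eqv_forth D; exists E => x x' /eqv_sym/hE xx' r y.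
by have [y' yy'] := xx' y; apply: h (eqv_sym yy') (r _).
Qed.

Lemma presburger_rename r R : presburger R ->
  presburger (fun x => R (fun i => x (r i))).
Proof.
move=> [D h]; have [E hE] := lin_rename D r.
(* [E] covers the renamed forms; the sum puts every [r i] with [i < D] below the bound, so that its
   residue is controlled. *)
exists (D + E + \sum_(i < D) (r i).+1) => x x' [h1 h2]; apply: h; split=> [i ltiD|f lf].
  have := fact_dvd (leq_trans (leq_addr E D) (leq_addr (\sum_(i < D) (r i).+1) _)).
  move/modn_dvd; apply; apply: h1.
  by rewrite (bigD1 (Ordinal ltiD)) //=; lia.
by apply: (h2 (fun x => f (fun i => x (r i)))); apply: lin_mono (hE _ lf); lia.
Qed.

Definition linear (f : env -> int) := exists D, lin D f.

Lemma presburger_ge0 f : linear f -> presburger (fun x => 0 <= f x)%R.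
Proof. by move=> [D lf]; exists D => x x' xx'; rewrite (xx'.2 f lf). Qed.

Lemma presburger_modn i M r : 0 < M -> presburger (fun x => x i = r %[mod M]).
Proof.
move=> M0; exists (i.+1 + M) => x x' [h _]; rewrite (modn_dvd _ (h i _)) //; last lia.
by apply: dvdn_fact; lia.
Qed.

Definition nlinear (f : env -> nat) := linear (fun x => (f x)%:Z).

Lemma nlinear_var i : nlinear (fun x => x i).
Proof. by exists i.+1; apply: lin_var. Qed.

Lemma nlinear_const n : nlinear (fun=> n).
Proof. by exists n; apply: (lin_const n%:Z). Qed.

Lemma nlinear_add f g : nlinear f -> nlinear g -> nlinear (fun x => f x + g x).
Proof. by move=> [D lf] [E lg]; exists (D + E); apply: eq_lin (lin_add lf lg) => x. Qed.

Lemma nlinear_mul n f : nlinear f -> nlinear (fun x => n * f x).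
Proof.
move=> [D lf]; exists (n * D); apply: eq_lin (lin_scale n%:Z lf) => x.
by rewrite PoszM.
Qed.

Lemma nlinear_sum (I : finType) (P : pred I) (f : I -> env -> nat) :
  (forall i, nlinear (f i)) -> nlinear (fun x => \sum_(i | P i) f i x).
Proof.
move=> h; have aux (s : seq I) : nlinear (fun x => \sum_(i <- s | P i) f i x).
  elim: s => [|i s [D lf]].
    by exists 0; apply: eq_lin (lin_const 0%R) => x; rewrite big_nil.
  have [E lg] := h i; exists (E + D).
  apply: (@eq_lin _ (fun x => (if P i then f i x else 0)%:Z +
                              (\sum_(i <- s | P i) f i x)%N%:Z)%R) => [x|].
    by rewrite big_cons; case: (P i).
  by apply: lin_add => //; case: (P i) => //; apply: lin_mono (lin_const 0%R).
by have [D lf] := aux (index_enum I); exists D.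
Qed.

Lemma presburger_le f g : nlinear f -> nlinear g -> presburger (fun x => f x <= g x).
Proof.
move=> [D lf] [E lg].
apply: (presburger_ext (R := fun x => 0 <= (g x)%:Z + (-1) * (f x)%:Z)%R) => [x|].
  by split; lia.
by apply: presburger_ge0; exists (E + 1 * D); apply: lin_add lg (lin_scale (-1)%R lf).
Qed.

Lemma presburger_lt f g : nlinear f -> nlinear g -> presburger (fun x => f x < g x).
Proof.
by move=> lf; apply: presburger_le; apply: (nlinear_add (nlinear_const 1) lf).
Qed.

Lemma presburger_eq f g : nlinear f -> nlinear g -> presburger (fun x => f x = g x).
Proof.
move=> lf lg; apply: presburger_ext (presburger_and (presburger_le lf lg) (presburger_le lg lf)).
by move=> x; split=> [[]|]; lia.
Qed.

Definition prepend (r : nat) (z x : env) : env :=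
  fun i => if i < r then z i else x (i - r).

Lemma presburger_prepend r R : presburger R ->
  presburger (fun x => exists z, R (prepend r z x)).
Proof.
elim: r R => [|r IH] R pR.
  apply: presburger_ext pR => x.
  have xE z : prepend 0 z x = x by apply: functional_extensionality => i; rewrite /prepend subn0.
  by split=> [|[z]]; [exists x|]; rewrite xE.
apply: presburger_ext (IH _ (presburger_ex pR)) => x.
have consE y z : prepend r.+1 (scons y z) x = scons y (prepend r z x).
  by apply: functional_extensionality => -[].
split=> [[z [y]]|[z]]; first by rewrite -consE; exists (scons y z).
have -> : z = scons (z 0) (fun i => z i.+1) by apply: functional_extensionality => -[].
by rewrite consE; exists (fun i => z i.+1), (z 0).
Qed.

(** A family indexed by [W] occupies the first coordinates, in the order of [enum_rank], and pushes
    the parameters up by [#|W|]; quantifying over it is then [#|W|] single quantifiers. *)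
Lemma presburger_ex_family (W : finType) (R : (W -> nat) -> env -> Prop) :
  presburger (fun x => R (fun w => x (enum_rank w)) (fun i => x (#|W| + i))) ->
  presburger (fun x => exists z, R z x).
Proof.
move/(presburger_prepend #|W|); apply: presburger_ext => x.
have restE z : (fun i => prepend #|W| z x (#|W| + i)) = x.
  by apply: functional_extensionality => i; rewrite /prepend ltnNge leq_addr addKn.
have headE z : (fun w : W => prepend #|W| z x (enum_rank w)) = fun w => z (enum_rank w).
  by apply: functional_extensionality => w; rewrite /prepend ltn_ord.
split=> [[z]|[z]]; first by rewrite restE headE; exists (fun w => z (enum_rank w)).
exists (fun i => oapp (fun j : 'I_#|W| => z (enum_val j)) 0 (insub i)).
rewrite restE headE; have -> // : (fun w : W => oapp (fun j : 'I_#|W| => z (enum_val j)) 0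
  (insub (val (enum_rank w)))) = z.
by apply: functional_extensionality => w; rewrite valK /= enum_rankK.
Qed.

(* The rank counts the thresholds passed by [y]: along the last coordinate, the
   type of [y] is periodic between two consecutive thresholds. *)
Lemma eqv_segments D : exists J, forall x, exists rk : nat -> 'I_J.+1,
  {homo rk : y y' / y <= y'} /\
  forall y y', rk y = rk y' -> y = y' %[mod D`!] -> eqv D (scons y x) (scons y' x).
Proof.
have [I [F [_ FP]]] := lin_finite (thr D).
exists #|I| => x; pose passed y := [set i | (F i x <= (D`! * y)%:Z)%R].
have passedS y y' : y <= y' -> passed y \subset passed y'.
  move=> leyy'; apply/subsetP => i; rewrite !inE => /le_trans; apply.
  by have := leq_mul2l D`! y y'; rewrite leyy' orbT; lia.
have rkP y : #|passed y| < #|I|.+1 by rewrite ltnS max_card.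
exists (fun y => Ordinal (rkP y)); split=> [y y' leyy'|y y' [eqc] eqm].
  exact/subset_leq_card/passedS.
apply: eqv_scons => // t lt; have [i iE] := FP t lt; rewrite -!iE.
(* The sets of passed thresholds are nested, so equal cardinality makes them equal. *)
suff /setP/(_ i) : passed y = passed y' by rewrite !inE.
case/orP: (leq_total y y') => /passedS sub.
  by apply/eqP; rewrite eqEcard sub eqc leqnn.
by apply/esym/eqP; rewrite eqEcard sub eqc leqnn.
Qed.

(** * Parikh's theorem *)

Lemma sum_count_mem (T : finType) (F : T -> nat) (s : seq T) :
  \sum_(x <- s) F x = \sum_x F x * count_mem x s.
Proof.
elim: s => [|y s IH]; first by rewrite big_nil big1 // => x _; rewrite muln0.
rewrite big_cons IH /=; under [RHS]eq_bigr do rewrite mulnDr.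
rewrite big_split /=; congr (_ + _); rewrite (bigD1 y) //= eqxx muln1 big1 ?addn0 // => x.
by rewrite eq_sym => /negbTE ->; rewrite muln0.
Qed.

Lemma count_sum (T S : finType) (f : T -> seq S) (y : S) (s : seq T) :
  count_mem y (flatten (map f s)) = \sum_(x <- s) count_mem y (f x).
Proof. by rewrite count_flatten -map_comp sumnE big_map. Qed.

Definition seq_of_counts (T : finType) (z : T -> nat) : seq T :=
  flatten [seq nseq (z x) x | x <- enum T].

Lemma count_seq_of_counts (T : finType) (z : T -> nat) x :
  count_mem x (seq_of_counts z) = z x.
Proof.
rewrite count_sum big_enum /= (bigD1 x) //= count_nseq /= eqxx mul1n.
by rewrite big1 ?addn0 // => y /negbTE yx; rewrite count_nseq /= yx.
Qed.

Section Grammar.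
Variables (N P : finType) (lhs : P -> N) (rhs : P -> seq N).

(** Leftmost derivations, with the stack of open nonterminals as first argument. The grammar has no
    terminals: what is generated is read off from the list of productions. *)
Inductive derives : seq N -> seq P -> Prop :=
| derives_nil : derives [::] [::]
| derives_step p al ps :
    derives (rhs p ++ al) ps -> derives (lhs p :: al) (p :: ps).

Definition balanced (al : seq N) (ps : seq P) :=
  perm_eq (al ++ flatten (map rhs ps)) (map lhs ps).

Definition closed_under (ps : seq P) (X : {set N}) :=
  all (fun p => (lhs p \in X) ==> all (mem X) (rhs p)) ps.

(** Every production of [ps] is reachable from [al], expressed through closed sets of nonterminals
    to keep it decidable. *)
Definition connected (al : seq N) (ps : seq P) :=
  [forall X : {set N}, all (mem X) al ==> closed_under ps X ==>
                       all (fun p => lhs p \in X) ps].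

Lemma connectedP al ps : reflect
  (forall X : {set N}, {subset al <= X} ->
    (forall p, p \in ps -> lhs p \in X -> {subset rhs p <= X}) ->
    forall p, p \in ps -> lhs p \in X) (connected al ps).
Proof.
apply: (iffP forallP) => h X.
  move=> alX psX; have /implyP/(_ _)/implyP/(_ _)/allP := h X; apply.
    exact/allP.
  by apply/allP => p pps; apply/implyP => pX; apply/allP/psX.
apply/implyP => /allP alX; apply/implyP => /allP psX; apply/allP/h => // p pps pX.
by have /implyP/(_ pX)/allP := psX p pps.
Qed.

(** Connectedness thus depends only on the support of the production counts, which leaves finitely
    many cases. *)
Lemma eq_mem_connected al ps ps' : ps =i ps' -> connected al ps = connected al ps'.
Proof.
move=> eps; apply/connectedP/connectedP => h X alX psX p pps; apply: h => //;
  try (by rewrite ?eps // -eps); by move=> q qps; apply: psX; rewrite ?eps // -eps.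
Qed.

Lemma derives_balanced al ps : derives al ps -> balanced al ps.
Proof.
elim=> // p be qs _ /= IH; rewrite /balanced /= perm_cons.
by apply: perm_trans IH; rewrite perm_catCA catA.
Qed.

Lemma derives_connected al ps : derives al ps -> connected al ps.
Proof.
elim=> [|p be qs _ /connectedP IH]; apply/connectedP => // X alX psX q.
have pX : lhs p \in X by apply: alX; rewrite mem_head.
rewrite inE => /predU1P[->//|]; apply: IH.
  move=> B; rewrite mem_cat => /orP[|Bbe]; last by apply: alX; rewrite inE Bbe orbT.
  by apply: psX pX B; rewrite mem_head.
by move=> r rqs; apply: psX; rewrite inE rqs orbT.
Qed.

Lemma balanced_step p al ps : p \in ps -> balanced (lhs p :: al) ps ->
  balanced (rhs p ++ al) (rem p ps).
Proof.
move=> pps; have prem := perm_to_rem pps.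
rewrite /balanced => h; rewrite -(perm_cons (lhs p)).
apply: perm_trans (perm_map lhs prem); apply: perm_trans h; rewrite /= perm_cons.
by rewrite -catA perm_catCA perm_cat2l perm_sym (perm_flatten (perm_map rhs prem)).
Qed.

(* If no production [p] for the first open nonterminal [B] could be applied
   next, the cuts [X] witnessing the disconnection would jointly contain every
   right-hand side but not [B]; by balance a single production for [B] would
   remain, and applying it disconnects nothing. *)
Lemma connected_step B al ps : balanced (B :: al) ps -> connected (B :: al) ps ->
  exists2 p, p \in ps & lhs p = B /\ connected (rhs p ++ al) (rem p ps).
Proof.
move=> /[dup] bal /perm_mem/(_ B); rewrite mem_head => /esym/mapP[p0 p0ps p0B].
move=> /connectedP conn; have [/existsP[p /and3P[pps /eqP pB pc]]|] :=
  boolP [exists p, [&& p \in ps, lhs p == B & connected (rhs p ++ al) (rem p ps)]].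
  by exists p.
rewrite negb_exists => /forallP disc; exfalso.
pose bad p (X : {set N}) :=
  [/\ {subset rhs p ++ al <= X},
      forall q, q \in rem p ps -> lhs q \in X -> {subset rhs q <= X}
    & exists2 q, q \in rem p ps & lhs q \notin X].
pose X_ p := odflt set0 [pick X : {set N} | [&& all (mem X) (rhs p ++ al),
  closed_under (rem p ps) X & ~~ all (fun q => lhs q \in X) (rem p ps)]].
have badX p : p \in ps -> lhs p = B -> bad p (X_ p).
  move=> pps pB; have := disc p; rewrite pps pB eqxx /= negb_forall => /existsP[X].
  rewrite !negb_imply /X_; case: pickP => [{}X /and3P[/allP sX /allP cX /allPn[q qps qX]] _|/(_ X)->//].
  split=> //; last by exists q.
  by move=> r /cX/implyP rX /rX/allP.
have inrem p q : q \in ps -> q != p -> q \in rem p ps.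
  by move=> qps qp; apply: rem_mem.
(* A cut containing [B] would contain the whole stack and be closed under [p] as well, against the
   connectedness of [B :: al]. *)
have badB p : p \in ps -> lhs p = B -> B \notin X_ p.
  move=> pps pB; have [sX cX [q qps /negP qX]] := badX p pps pB.
  apply/negP => BX; apply: qX; apply: conn (mem_rem qps) => [C|r rps rX].
    by rewrite inE => /predU1P[->//|Cal]; apply: sX; rewrite mem_cat Cal orbT.
  have [->|/(inrem _ _ rps)/cX] := eqVneq r p; last exact.
  by move=> C Cp; apply: sX; rewrite mem_cat Cp.
pose Z := \bigcup_(p | (p \in ps) && (lhs p == B)) X_ p.
have XZ p : p \in ps -> lhs p = B -> {subset X_ p <= Z}.
  by move=> pps pB; apply/subsetP/bigcup_sup; rewrite pps pB eqxx.
have BZ : B \notin Z.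
  by apply/bigcupP => -[p /andP[pps /eqP pB]]; apply/negP/badB.
have rhsZ q : q \in ps -> lhs q \in B |: Z -> {subset rhs q <= Z}.
  move=> qps; rewrite in_setU1 => /predU1P[qB C Cq|/bigcupP[p /andP[pps /eqP pB] qX] C Cq].
    by apply: (XZ q) => //; have [sX _ _] := badX q qps qB; apply: sX; rewrite mem_cat Cq.
  have [_ cX _] := badX p pps pB; apply: (XZ p) => //; apply: cX Cq => //.
  by apply: inrem => //; apply: contraNneq (badB p pps pB) => qp; move: qX; rewrite qp pB.
have alZ : {subset al <= Z}.
  have [sX _ _] := badX p0 p0ps (esym p0B).
  by move=> C Cal; apply: (XZ p0) => //; apply: sX; rewrite mem_cat Cal orbT.
have lhsZ q : q \in ps -> lhs q \in B |: Z.
  move: q; apply: conn => [C|q qps qZ C Cq]; rewrite !inE.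
    by case: eqP => //= _ /alZ.
  by rewrite (rhsZ q) ?orbT.
have count0 (s : seq N) : {subset s <= Z} -> count_mem B s = 0.
  by move=> sZ; apply/count_memPn/negP => /sZ; apply/negP.
have flat0 : {subset flatten (map rhs ps) <= Z}.
  by move=> C /flatten_mapP[r rps]; apply: rhsZ => //; apply: lhsZ.
(* [B] occurs neither in [al] nor in any right-hand side, so balance allows it only one
   production. *)
have remB r : r \in rem p0 ps -> lhs r != B.
  move=> rrem; apply/eqP => rB.
  have := permP bal (pred1 B); rewrite (permP (perm_map lhs (perm_to_rem p0ps))) /=.
  rewrite count_cat -p0B eqxx (count0 al) // (count0 (flatten _)) // => /eqP.
  rewrite eqn_add2l eq_sym -leqn0 leqNgt -has_count => /hasP; apply.
  by exists B; rewrite //= -rB map_f.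
have [sX cX [q qps qX]] := badX p0 p0ps (esym p0B).
have : lhs q \in B |: X_ p0; last by rewrite in_setU1 (negbTE qX) (negbTE (remB q qps)).
apply: conn (mem_rem qps) => [C|r rps].
  by rewrite !inE => /predU1P[->|Cal]; rewrite ?eqxx // (sX C) ?orbT // mem_cat Cal orbT.
move=> rX C Cr; rewrite inE; have [rp|/(inrem _ _ rps) rrem] := eqVneq r p0.
  by rewrite (sX C) ?orbT // mem_cat -rp Cr.
move: rX; rewrite in_setU1 (negbTE (remB r rrem)) /= => rX.
by rewrite (cX r rrem rX C Cr) orbT.
Qed.

(** Converse, up to order, of the two necessary conditions above: [connected_step] supplies the next
    production, and each one applied shortens the list. *)
Lemma balanced_connected_derives al ps : balanced al ps -> connected al ps ->
  exists2 ps', perm_eq ps ps' & derives al ps'.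
Proof.
have [n] := ubnP (size ps); elim: n al ps => // n IH [|B al] ps sz bal conn.
  case: ps {sz bal} conn => [|p qs] /connectedP conn.
    by exists [::] => //; apply: derives_nil.
  suff : lhs p \in set0 by rewrite in_set0.
  by apply: conn (mem_head _ _) => // r _; rewrite in_set0.
have [p pps [pB pc]] := connected_step bal conn.
rewrite -pB in bal; have [|ps' pps' d] := IH _ _ _ (balanced_step pps bal) pc.
  by rewrite size_rem //; case: (ps) pps sz.
exists (p :: ps'); first by rewrite (permPl (perm_to_rem pps)) perm_cons.
by rewrite -pB; apply: derives_step.
Qed.

Variables (T : finType) (weight : P -> T -> nat).

(* By balance and connectedness, the possible numbers of uses
   of the productions are given by linear equations and a condition on the set
   of productions which are used at all. *)
Lemma presburger_derives (A : N) : presburger (fun x =>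
  exists ps, derives [:: A] ps /\
             forall t : T, x (enum_rank t) = \sum_(p <- ps) weight p t).
Proof.
pose sols (z : P -> nat) (x : env) :=
  [/\ exists U : {set P}, connected [:: A] (enum U) /\
         forall p, (z p == 0) = (p \notin U),
      forall B, (A == B) + \sum_p count_mem B (rhs p) * z p = \sum_p (lhs p == B) * z p
    & forall t, x (enum_rank t) = \sum_p weight p t * z p].
apply: (@presburger_ext (fun x => exists z, sols z x)) => [x|]; last first.
  apply: presburger_ex_family; apply: (@presburger_ext (fun x => _ /\ _ /\ _)) => [x|].
    by split=> [[h1 [h2 h3]]|[h1 h2 h3]]; [split; [exact: h1|exact: h2|exact: h3]|].
  apply: presburger_and; last apply: presburger_and.
  - apply: presburger_ex_fin => U; apply: presburger_and; first exact: presburger_const.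
    apply: presburger_all_fin => p.
    have := presburger_eq (nlinear_var (enum_rank p)) (nlinear_const 0).
    case: (p \in U) => h; last by apply: presburger_ext h => y; apply: (rwP eqP).
    by apply: presburger_ext (presburger_not h) => y; split=> [/eqP/negbTE|/negbT/eqP].
  - apply: presburger_all_fin => B; apply: presburger_eq.
      apply: nlinear_add; first exact: nlinear_const.
      by apply: nlinear_sum => p; apply: nlinear_mul; apply: nlinear_var.
    by apply: nlinear_sum => p; apply: nlinear_mul; apply: nlinear_var.
  apply: presburger_all_fin => t; apply: presburger_eq; first exact: nlinear_var.
  by apply: nlinear_sum => p; apply: nlinear_mul; apply: nlinear_var.
have balE ps : balanced [:: A] ps <-> forall B,
    (A == B) + \sum_p count_mem B (rhs p) * count_mem p ps =
    \sum_p (lhs p == B) * count_mem p ps.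
  have cE B : count_mem B ([:: A] ++ flatten (map rhs ps)) =
      (A == B) + \sum_p count_mem B (rhs p) * count_mem p ps.
    by rewrite count_cat count_sum /= addn0 (sum_count_mem (fun p => count_mem B (rhs p))).
  have dE B : count_mem B (map lhs ps) = \sum_p (lhs p == B) * count_mem p ps.
    rewrite -sum_count_mem count_map -sum1_count big_mkcond /=.
    by apply: eq_bigr => p _; case: eqP.
  split=> [/permP h B|h]; first by rewrite -cE -dE h.
  by apply/allP => B _; apply/eqP; apply: etrans (cE B) (etrans (h B) (esym (dE B))).
split=> [[z [[U [conn supp]] bal weq]]|[ps [der weq]]].
  pose ps := seq_of_counts z; have zE p : count_mem p ps = z p := count_seq_of_counts z p.
  have psU : enum U =i ps.
    move=> p; rewrite mem_enum -has_pred1 has_count zE.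
    by rewrite lt0n supp negbK.
  have [||qs pq dq] := @balanced_connected_derives [:: A] ps.
  - apply/balE => B; under eq_bigr => p _ do rewrite zE.
    by rewrite bal; under [RHS]eq_bigr => p _ do rewrite zE.
  - by rewrite -(eq_mem_connected _ psU).
  exists qs; split=> // t; rewrite -(perm_big _ pq) weq [RHS]sum_count_mem.
  by apply: eq_bigr => p _; rewrite zE.
exists (fun p => count_mem p ps); split.
- exists [set p in ps]; split.
    rewrite (@eq_mem_connected _ _ ps) ?derives_connected // => p.
    by rewrite mem_enum inE.
  by move=> p; rewrite inE -has_pred1 has_count lt0n negbK.
- exact/balE/derives_balanced.
- by move=> t; rewrite weq sum_count_mem.
Qed.
End Grammar.

(** * Bracketed runs of a finite graph *)

Section Runs.
Variables (Q G Ed : finType) (src tgt : Ed -> Q) (lab : Ed -> G).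
Variable op : G -> G -> G.

Fixpoint run (q : Q) (es : seq Ed) (q' : Q) : bool :=
  if es is e :: es' then (src e == q) && run (tgt e) es' q' else q == q'.

Lemma run_cat q s q' es es' : run q es s -> run s es' q' -> run q (es ++ es') q'.
Proof.
elim: es q => [|e es IH] q /=; first by move/eqP=> ->.
by case/andP=> -> h1 h2; apply: IH.
Qed.

Lemma run_split q q' es es' : run q (es ++ es') q' ->
  exists2 s, run q es s & run s es' q'.
Proof.
elim: es q => [|e es IH] q /=; first by exists q.
by case/andP=> qe /IH[s h1 h2]; exists s; rewrite ?qe.
Qed.

(* A nonterminal [(q, g, q')] generates the runs from [q] to [q'] whose labels
   can be bracketed so as to evaluate to [g]. *)
Let nonterm : finType := (Q * G * Q)%type.
(** A left summand splits a run at the state [s]; an edge closes its nonterminal and plays the part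
    of a terminal. *)
Let prod : finType := ((Q * G * Q * G * Q) + Ed)%type.

Let plhs (p : prod) : nonterm :=
  match p with
  | inl (q, g, s, h, q') => (q, op g h, q')
  | inr e => (src e, lab e, tgt e)
  end.

Let prhs (p : prod) : seq nonterm :=
  if p is inl (q, g, s, h, q') then [:: (q, g, s); (s, h, q')] else [::].

Let edges_of (ps : seq prod) : seq Ed :=
  pmap (fun p : prod => if p is inr e then Some e else None) ps.

Let generates (A : nonterm) (es : seq Ed) : Prop :=
  let: (q, g, q') := A in run q es q' /\ evaluates op (map lab es) g.

Fixpoint generates_all (al : seq nonterm) (es : seq Ed) : Prop :=
  if al is A :: al' then
    exists es1 es2, [/\ es = es1 ++ es2, generates A es1 & generates_all al' es2]
  else es = [::].

(** Since derivations are leftmost, the edges among the productions come in the order of the run. *)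
Lemma derives_generates al ps : derives plhs prhs al ps -> generates_all al (edges_of ps).
Proof.
elim=> // -[[[[[q g] s] h] q']|e] be qs _ /=.
  move=> [es1 [es2 [-> [r1 v1] [es3 [es4 [-> [r2 v2] hbe]]]]]].
  exists (es1 ++ es3), es4; rewrite catA; split=> //; split; first exact: run_cat r1 r2.
  by rewrite map_cat; apply: evaluates_op.
move=> hbe; exists [:: e], (edges_of qs); split=> //=; split; first by rewrite /= !eqxx.
exact: evaluates_letter.
Qed.

(** The pending stack [al] and its derivation [ps'] are carried along so that derivations of the two
    factors can be chained. *)
Lemma generates_derives w g : evaluates op w g -> forall es q q',
  w = map lab es -> run q es q' -> exists2 ps, edges_of ps = es &
  forall al ps', derives plhs prhs al ps' -> derives plhs prhs ((q, g, q') :: al) (ps ++ ps').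
Proof.
elim=> [{}g|u v {}g h _ IHu _ IHv] es q q'.
  case: es => [|e []] // [->] /andP[/eqP<- /eqP<-].
  by exists [:: inr e] => // al ps'; apply: (@derives_step _ _ plhs prhs (inr e)).
move=> wE; rewrite -(cat_take_drop (size u) es) => /run_split[s r1 r2].
have [|ps1 e1 d1] := IHu _ _ _ _ r1.
  by rewrite map_take -wE take_size_cat.
have [|ps2 e2 d2] := IHv _ _ _ _ r2.
  by rewrite map_drop -wE drop_size_cat.
exists (inl (q, g, s, h, q') :: ps1 ++ ps2).
  by rewrite /edges_of /= pmap_cat -/(edges_of ps1) -/(edges_of ps2) e1 e2.
move=> al ps' d; rewrite cat_cons -catA.
by apply: (@derives_step _ _ plhs prhs (inl (q, g, s, h, q'))); apply: d1; apply: d2.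
Qed.

Lemma presburger_runs q g q' : presburger (fun x =>
  exists es, [/\ run q es q', evaluates op (map lab es) g
               & forall e, x (enum_rank e) = count_mem e es]).
Proof.
pose weight (p : prod) (e : Ed) : nat := if p is inr e' then e' == e else 0.
apply: presburger_ext (presburger_derives plhs prhs weight (q, g, q')) => x.
have wE ps e : \sum_(p <- ps) weight p e = count_mem e (edges_of ps).
  elim: ps => [|p ps IH]; first by rewrite big_nil.
  by rewrite big_cons IH; case: p.
split=> [[ps [/derives_generates der xE]]|[es [r v xE]]].
  move: der => /= [es1 [es2 [esE [r v] es20]]]; rewrite es20 cats0 in esE.
  by exists es1; split=> // e; rewrite xE wE esE.
have [ps psE d] := generates_derives v (erefl _) r.
exists ps; split=> [|e]; last by rewrite xE wE psE.
by have := d _ _ (derives_nil _ _); rewrite cats0.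
Qed.
End Runs.

(** * Formulas over unary words *)

Lemma selects_ext (T : Type) t (b : 'I_t.+1 -> T) (P P' : 'I_t -> Prop) c :
  (forall j, P j <-> P' j) -> selects b P c -> selects b P' c.
Proof.
move=> PP' [[j [/PP' Pj nP ->]]|[nP ->]]; [left; exists j|right]; split=> //.
  by move=> i ij /PP'; apply: nP.
by move=> j /PP'; apply: nP.
Qed.

Lemma selects_inj (T : Type) t (b : 'I_t.+1 -> T) (P : 'I_t -> Prop) c c' :
  selects b P c -> selects b P c' -> c = c'.
Proof.
move=> [[j [Pj nPj ->]]|[nP ->]] [[j' [Pj' nPj' ->]]|[nP' ->]] //.
- by congr (b _); apply: val_inj => /=; case: (ltngtP j j') => // [/nPj'|/nPj] [].
- by case: (nP' _ Pj).
- by case: (nP _ Pj').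
Qed.

Lemma presburger_selects (T : Type) t (b : 'I_t.+1 -> T) (R : 'I_t -> env -> Prop) c :
  (forall j, presburger (R j)) -> presburger (fun x => selects b (R^~ x) c).
Proof.
move=> pR; apply: (@presburger_ext (fun x =>
    (exists j : 'I_t, R j x /\ (forall i : 'I_t, i < j -> ~ R i x) /\
                      c = b (widen_ord (leqnSn t) j)) \/
    ((forall j : 'I_t, ~ R j x) /\ c = b ord_max))) => [x|].
  rewrite /selects; split=> -[[j]|]; try by right.
    by case=> h1 [h2 h3]; left; exists j.
  by case=> h1 h2 h3; left; exists j.
apply: presburger_or.
  apply: presburger_ex_fin => j; apply: presburger_and; first exact: pR.
  apply: presburger_and (presburger_const _); apply: presburger_all_fin => i.
  by apply: presburger_imp (presburger_const _) _; apply: presburger_not.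
by apply: presburger_and (presburger_const _); apply: presburger_all_fin => j; apply: presburger_not.
Qed.

(** In a sorted list the copies of [i] form one block, located by counts alone; this is why the
    Parikh image of a run determines which segment each position lies in. *)
Lemma nth_sorted_eq (s : seq nat) y i : sorted leq s -> y < size s ->
  (nth 0 s y == i) = (count (fun k => k < i) s <= y < count (fun k => k <= i) s).
Proof.
move=> ss ys; apply/eqP/idP => [<-|]; last exact: (@nth_count_eq _ nat i 0 s y ss).
apply/andP; split; rewrite leqNgt; apply/negP => h.
  have := @nth_count_lt _ nat (nth 0 s y) 0 s y ss.
  by move=> /(_ h); rewrite ltxx.
have := @nth_count_gt _ nat (nth 0 s y) 0 s y ss.
by rewrite ys andbT -ltnS => /(_ h); rewrite ltxx.
Qed.

(** * Runs through segments and residues *)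

Section SegmentGraph.
Variables (J M : nat) (M0 : 0 < M).

Definition phase (y : nat) : 'I_M := Ordinal (ltn_pmod y M0).

(* A state records the segment of a position and its residue modulo [M]; runs
   may only move on to later segments. *)
Definition segment_edge : finType := ('I_J.+1 * 'I_J.+1 * 'I_M)%type.

Definition segment (e : segment_edge) : nat := e.1.1.

Definition segment_src (e : segment_edge) : 'I_J.+1 * 'I_M := (e.1.1, e.2).

(** An edge asking for an earlier segment stays in its own, so that every triple is a legal edge. *)
Definition segment_tgt (e : segment_edge) : 'I_J.+1 * 'I_M :=
  (if e.1.1 <= e.1.2 then e.1.2 else e.1.1, phase e.2.+1).

Lemma phaseS (r : 'I_M) y : r = phase y -> phase r.+1 = phase y.+1.
Proof. by move=> ->; apply: val_inj; rewrite /= -addn1 modnDml addn1. Qed.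

Lemma segment_run_sorted q es q' : run segment_src segment_tgt q es q' ->
  sorted leq (map segment es).
Proof.
suff h m : m <= q.1 -> run segment_src segment_tgt q es q' ->
    path leq m (map segment es) by move/(h 0 isT)/path_sorted.
elim: es q m => //= e es IH q m mq /andP[/eqP qe] r.
rewrite -qe /= in mq; rewrite mq; apply: IH r => /=.
by case: ifP.
Qed.

Lemma segment_run_phase e0 q es q' a y : run segment_src segment_tgt q es q' ->
  q.2 = phase a -> y < size es -> (nth e0 es y).2 = phase (a + y).
Proof.
elim: es q a y => //= e es IH q a y /andP[/eqP qe r] qa.
rewrite -qe in qa; case: y => [|y] ys /=; first by rewrite addn0.
by rewrite addnS -addSn; apply: IH r _ _ => //=; apply: phaseS.
Qed.

Lemma segment_run_iota (rk : nat -> 'I_J.+1) a n : {homo rk : y y' / y <= y'} ->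
  run segment_src segment_tgt (rk a, phase a)
    [seq ((rk y, rk y.+1, phase y) : segment_edge) | y <- iota a n] (rk (a + n), phase (a + n)).
Proof.
move=> rkm; elim: n a => [|n IH] a /=; first by rewrite addn0.
rewrite /segment_src /= eqxx /segment_tgt /= rkm //= (phaseS (erefl (phase a))).
by rewrite addnS -addSn; apply: IH.
Qed.

Lemma segment_nth e0 q es q' y (i : 'I_J.+1) :
  run segment_src segment_tgt q es q' -> y < size es ->
  ((nth e0 es y).1.1 == i) =
  (\sum_(e | segment e < i) count_mem e es <= y < \sum_(e | segment e <= i) count_mem e es).
Proof.
move=> r ys; have := @nth_sorted_eq (map segment es) y i.
rewrite size_map (nth_map e0) // -[LHS]/((nth e0 es y).1.1 == i) => -> //; last exact: segment_run_sorted r.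
have cE (P : pred nat) : count P (map segment es) =
    \sum_(e | P (segment e)) count_mem e es.
  rewrite count_map -sum1_count big_mkcond sum_count_mem [RHS]big_mkcond /=.
  by apply: eq_bigr => e _; case: (P _); rewrite ?mul1n ?mul0n.
by rewrite !cE.
Qed.
End SegmentGraph.

(** * Formulas over unary words as relations on environments *)

Section Words.
Variable K : language_class.
Notation form := (Defs.form unit false K).

Definition ones (n : nat) : n.-tuple unit := nseq_tuple n tt.

(** Coordinates below [k] are the values of the free variables, coordinate [k] is the last position.
    Environments with a variable out of range satisfy nothing. *)
Definition holds k (phi : form k) (x : env) : Prop :=
  exists e : k.-tuple 'I_(x k).+1,
    (forall i, tnth e i = x i :> nat) /\ sat (ones _) phi e.

Definition in_range k (x : env) : Prop := forall i : 'I_k, x i <= x k.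

Lemma in_rangeP k x : in_range k x <->
  exists e : k.-tuple 'I_(x k).+1, forall i, tnth e i = x i :> nat.
Proof.
split=> [xk|[e eE] i]; last by rewrite -eE -ltnS.
by exists [tuple inord (x i) | i < k] => i; rewrite tnth_mktuple inordK ?ltnS.
Qed.

Lemma holdsP k (phi : form k) x (e : k.-tuple 'I_(x k).+1) :
  (forall i, tnth e i = x i :> nat) -> holds phi x <-> sat (ones _) phi e.
Proof.
move=> eE; split=> [[e' [eE' h]]|h]; last by exists e.
suff -> : e = e' by [].
by apply: eq_from_tnth => i; apply: val_inj; rewrite /= eE eE'.
Qed.

Lemma holds_scons k (phi : form k.+1) x (e : k.-tuple 'I_(x k).+1) (y : 'I_(x k).+1) :
  (forall i, tnth e i = x i :> nat) ->
  holds phi (scons y x) <-> sat (ones _) phi [tuple of y :: e].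
Proof.
move=> eE; apply: (@holdsP _ phi (scons y x) [tuple of y :: e]) => -[[|i] ik] /=.
  by rewrite (tnth_nth y).
by rewrite (tnth_nth y) /= -(eE (Ordinal (ik : i < k))) (tnth_nth y).
Qed.

Lemma holds_scons_le k (phi : form k.+1) x y : holds phi (scons y x) -> y <= x k.
Proof. by move=> [e [eE _]]; rewrite -[y]/(scons y x (@ord0 k)) -eE -ltnS. Qed.

Lemma presburger_in_range k : presburger (in_range k).
Proof.
by apply: presburger_all_fin => i; apply: presburger_le; apply: nlinear_var.
Qed.

Definition term_value k (u : term k) (x : env) : nat :=
  match u with Var i => x i | Min => 0 | Max => x k end.

Lemma eval_termE k (u : term k) x (e : k.-tuple 'I_(x k).+1) :
  (forall i, tnth e i = x i :> nat) -> eval_term e u = term_value u x :> nat.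
Proof. by case: u => /=. Qed.

Lemma nlinear_term k (u : term k) : nlinear (term_value u).
Proof. by case: u => [i||]; [exact: nlinear_var|exact: nlinear_const|exact: nlinear_var]. Qed.

Lemma presburger_holds_ext k (phi : form k) R : presburger R ->
  (forall (x : env) (e : k.-tuple 'I_(x k).+1),
    (forall i, tnth e i = x i :> nat) -> sat (ones _) phi e <-> R x) ->
  presburger (holds phi).
Proof.
move=> pR h; apply: presburger_ext (presburger_and (presburger_in_range k) pR) => x.
split=> [[/in_rangeP[e eE] r]|[e [eE /(h _ _ eE) r]]]; first by exists e; split=> //; apply/h.
by split=> //; apply/in_rangeP; exists e.
Qed.
End Words.

(** * Groupoidal quantifiers over unary words *)

Section Quantifier.
Variables (T : finType) (op : T -> T -> T) (S : {set T}).
Variables (k t : nat) (b : 'I_t.+1 -> T).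
Variable f : 'I_t -> Defs.form unit false Grp k.+1.
Variables (D J : nat).
Hypothesis eqv_holds : forall j x x', eqv D x x' -> holds (f j) x -> holds (f j) x'.
Hypothesis segments : forall x, exists rk : nat -> 'I_J.+1,
  {homo rk : y y' / y <= y'} /\
  forall y y', rk y = rk y' -> y = y' %[mod D`!] -> eqv D (scons y x) (scons y' x).
Hypothesis presburger_f : forall j, presburger (holds (f j)).

Notation M0 := (fact_gt0 D).
Notation edge := (segment_edge J D`!).
Notation state := ('I_J.+1 * 'I_(D`!))%type.

(** [pi] is a guess of the letter read at each segment and residue; there are finitely many
    guesses. *)
Definition labelling (pi : {ffun state -> T}) (e : edge) : T := pi (segment_src e).

(* The word read by the quantifier is the one spelled by a run with edge counts
   [c]: position [y] lies in segment [i] when it lies between two partial sums. *)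
Definition spells (pi : {ffun state -> T}) (c : edge -> nat) (x : env) : Prop :=
  forall (y : nat) (i : 'I_J.+1) (r : 'I_(D`!)),
    \sum_(e | segment e < i) c e <= y ->
    y < \sum_(e | segment e <= i) c e ->
    y = r %[mod D`!] ->
    selects b (fun j => holds (f j) (scons y x)) (pi (i, r)).

Definition accepted (pi : {ffun state -> T}) (q q' : state) (g : T) (x : env) : Prop :=
  exists c : edge -> nat,
    [/\ exists es, [/\ run (@segment_src J D`!) (segment_tgt M0) q es q',
          evaluates op (map (labelling pi) es) g & forall e, c e = count_mem e es],
        \sum_e c e = (x k).+1 & spells pi c x].

Lemma presburger_spells pi :
  presburger (fun x => spells pi (fun e => x (enum_rank e)) (fun i => x (#|{: edge}| + i))).
Proof.
(* [rn] skips the block of edge counts that sits between the position [y] and the parameters. *)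
pose rn i := if i is j.+1 then (#|{: edge}| + j).+1 else 0.
apply: (@presburger_ext (fun x => forall y (i : 'I_J.+1) (r : 'I_(D`!)),
    \sum_(e | segment e < i) scons y x (enum_rank e).+1 <= scons y x 0 ->
    scons y x 0 < \sum_(e | segment e <= i) scons y x (enum_rank e).+1 ->
    scons y x 0 = r %[mod D`!] ->
    selects b (fun j => holds (f j) (fun i => scons y x (rn i))) (pi (i, r)))) => [x|].
  have rnE y : (fun i => scons y x (rn i)) = scons y (fun i => x (#|{: edge}| + i)).
    by apply: functional_extensionality => -[].
  by split=> h y i r; have := h y i r; rewrite /= ?rnE; apply.
apply: (presburger_all (R := fun x => forall (i : 'I_J.+1) (r : 'I_(D`!)),
    \sum_(e | segment e < i) x (enum_rank e).+1 <= x 0 ->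
    x 0 < \sum_(e | segment e <= i) x (enum_rank e).+1 ->
    x 0 = r %[mod D`!] ->
    selects b (fun j => holds (f j) (fun i => x (rn i))) (pi (i, r)))).
have lsum (P : pred edge) : nlinear (fun x => \sum_(e | P e) x (enum_rank e).+1).
  by apply: nlinear_sum => e; apply: nlinear_var.
apply: presburger_all_fin => i; apply: presburger_all_fin => r.
apply: presburger_imp; first exact: presburger_le (lsum _) (nlinear_var 0).
apply: presburger_imp; first exact: presburger_lt (nlinear_var 0) (lsum _).
apply: presburger_imp; first exact: presburger_modn M0.
by apply: presburger_selects => j; apply: presburger_rename.
Qed.

Lemma presburger_accepted pi q q' g : presburger (accepted pi q q' g).
Proof.
apply: presburger_ex_family; apply: (@presburger_ext (fun x => _ /\ _ /\ _)) => [x|].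
  by split=> [[h1 [h2 h3]]|[h1 h2 h3]]; [split; [exact: h1|exact: h2|exact: h3]|].
apply: presburger_and; first exact: presburger_runs.
apply: presburger_and (presburger_spells pi).
apply: presburger_eq; last exact: nlinear_add (nlinear_const 1) (nlinear_var _).
by apply: nlinear_sum => e; apply: nlinear_var.
Qed.

Lemma eqv_selects x y y' c : eqv D (scons y x) (scons y' x) ->
  selects b (fun j => holds (f j) (scons y x)) c ->
  selects b (fun j => holds (f j) (scons y' x)) c.
Proof.
by move=> h; apply: selects_ext => j; split; apply: eqv_holds => //; apply: eqv_sym.
Qed.

(** Positions with the same segment and residue satisfy the same formulas [f j], so the selected
    word factors through the states and is spelled by the run following [rk]. *)
Lemma selected_word_accepted x (v : (x k).+1.-tuple T) g :
  (forall y : 'I_(x k).+1, selects b (fun j => holds (f j) (scons y x)) (tnth v y)) ->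
  evaluates op v g ->
  exists (pi : {ffun state -> T}) (q q' : state), q.2 = phase M0 0 /\ accepted pi q q' g x.
Proof.
move=> vP vg; have [rk [rkm rkP]] := segments x; set n := (x k).+1 in v vP vg.
(* States visited by no position get the dummy letter [b ord0]. *)
pose pi : {ffun state -> T} := [ffun q : state => if [pick y : 'I_n | (rk y == q.1) && (phase M0 y == q.2)]
                              is Some y then tnth v y else b ord0].
have piP (y : nat) : y < n ->
    selects b (fun j => holds (f j) (scons y x)) (pi (rk y, phase M0 y)).
  move=> yn; rewrite ffunE /=; case: pickP => [y' /andP[/eqP rky /eqP phy]|/(_ (Ordinal yn))].
    by apply: eqv_selects (vP y'); apply: rkP => //; case: phy.
  by rewrite !eqxx.
pose es := [seq ((rk y, rk y.+1, phase M0 y) : edge) | y <- iota 0 n].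
have szE : size es = n by rewrite size_map size_iota.
have r := segment_run_iota M0 0 n rkm.
exists pi, (rk 0, phase M0 0), (rk n, phase M0 n); split=> //.
exists (fun e => count_mem e es); split.
- exists es; split=> //; suff -> : map (labelling pi) es = v by [].
  apply: (@eq_from_nth _ (b ord0)) => [|y]; rewrite size_map szE ?size_tuple // => yn.
  rewrite (nth_map (rk 0, rk 0, phase M0 0)) ?szE // (nth_map 0) ?size_iota // nth_iota //.
  rewrite add0n /labelling /segment_src /= -(tnth_nth (b ord0) v (Ordinal yn)).
  exact: selects_inj (piP y yn) (vP (Ordinal yn)).
- have := sum_count_mem (fun=> 1) es; rewrite sum1_size szE /n => ->.
  by apply: eq_bigr => e _; rewrite mul1n.
- move=> y i q' ge lt yq'.
  have yn : y < n.
    apply: leq_trans lt _; rewrite -szE -sum1_size sum_count_mem big_mkcond /=.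
    by apply: leq_sum => e _; case: ifP; rewrite ?mul1n.
  have := segment_nth (rk 0, rk 0, phase M0 0) i r (y := y).
  rewrite szE ge lt (nth_map 0) ?size_iota // nth_iota // add0n => /(_ yn)/eqP /= <-.
  suff -> : q' = phase M0 y by apply: piP.
  by apply: val_inj; rewrite /= yq' modn_small.
Qed.

(** Whatever segments the run visits, [spells] certifies its label at each position to be the
    selected letter. *)
Lemma accepted_selected_word x pi (q q' : state) g : q.2 = phase M0 0 -> accepted pi q q' g x ->
  exists v : (x k).+1.-tuple T, evaluates op v g /\
    forall y : 'I_(x k).+1, selects b (fun j => holds (f j) (scons y x)) (tnth v y).
Proof.
move=> q0 [c [[es [r ev cE]] sumc sp]].
have szE : size es = (x k).+1.
  rewrite -sumc -sum1_size sum_count_mem; apply: eq_bigr => e _; by rewrite mul1n cE.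
have szv : size (map (labelling pi) es) == (x k).+1 by rewrite size_map szE.
exists (Tuple szv); split=> // y; pose e0 : edge := (q.1, q.1, q.2).
have ys : y < size es by rewrite szE.
rewrite (tnth_nth (b ord0)) /= (nth_map e0) // /labelling /segment_src.
have := segment_nth e0 (nth e0 es y).1.1 r ys; rewrite eqxx => /esym/andP[ge lt].
apply: sp.
- by under eq_bigr do rewrite cE.
- by under eq_bigr do rewrite cE.
- by rewrite (segment_run_phase e0 r q0 ys) /= modn_mod.
Qed.

Lemma presburger_quantifier (L : language T) (KL : Grp L) (bb : bijective b) :
  (forall w, L w <-> word_problem op S w) -> presburger (holds (Qun KL bb f)).
Proof.
(* A finite disjunction over the guess, the two ends of the run and the value; the run starts at
   residue 0 because positions are counted from 0. *)
move=> LE; apply: (@presburger_holds_ext _ _ _ (fun x =>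
  exists (p : {ffun state -> T} * state * state * T),
    (p.1.1.2.2 = phase M0 0 /\ p.2 \in S) /\ accepted p.1.1.1 p.1.1.2 p.1.2 p.2 x)).
  apply: presburger_ex_fin => p; apply: presburger_and (presburger_const _) _.
  exact: presburger_accepted.
move=> x e eE /=.
have selE (v : (x k).+1.-tuple T) y :
    selects b (fun j => sat (ones _) (f j) [tuple of y :: e]) (tnth v y) <->
    selects b (fun j => holds (f j) (scons y x)) (tnth v y).
  by split; apply: selects_ext => j; [apply: iff_sym|]; apply: holds_scons.
split=> [[v [vP /LE[g gS ev]]]|[[[[pi q] q'] g] /= [[q0 gS] acc]]].
  have [|pi [q [q' [q0 acc]]]] := selected_word_accepted (v := v) _ ev.
    by move=> y; apply/selE.
  by exists (pi, q, q', g).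
have [v [ev vP]] := accepted_selected_word q0 acc.
by exists v; split=> [y|]; [apply/selE|apply/LE; exists g].
Qed.
End Quantifier.

Lemma presburger_holds k (phi : Defs.form unit false Grp k) : presburger (holds phi).
Proof.
(* The [Bit] case is vacuous, as such an atom carries a proof of [false]. *)
elim: phi => {k} [k a u|k u v|k u v|k //|k f IHf|k f IHf g IHg|k f IHf g IHg|k f IHf|k f IHf|].
- apply: (presburger_holds_ext (presburger_const True)) => x e eE /=.
  by split=> // _; case: (tnth _ _) a => -[].
- apply: (presburger_holds_ext (presburger_lt (nlinear_term u) (nlinear_term v))).
  by move=> x e eE; rewrite -!(eval_termE _ eE).
- apply: (presburger_holds_ext (presburger_eq (nlinear_term u) (nlinear_term v))).
  by move=> x e eE; rewrite -!(eval_termE _ eE) /=; split=> [->|/val_inj].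
- apply: (presburger_holds_ext (presburger_not IHf)) => x e eE /=.
  by have := holdsP f eE; tauto.
- apply: (presburger_holds_ext (presburger_and IHf IHg)) => x e eE /=.
  by have := holdsP f eE; have := holdsP g eE; tauto.
- apply: (presburger_holds_ext (presburger_or IHf IHg)) => x e eE /=.
  by have := holdsP f eE; have := holdsP g eE; tauto.
- apply: (presburger_holds_ext (presburger_ex IHf)) => x e eE /=.
  split=> [[y /(holds_scons f y eE)]|[y hy]]; first by exists y.
  have yx := holds_scons_le hy; exists (Ordinal (yx : y < (x k).+1)).
  exact/(holds_scons f _ eE).
(* The guard [y <= x k] is essential, since [holds f] fails beyond the last position. *)
- apply: (presburger_holds_ext (R := fun x => forall y, y <= x k -> holds f (scons y x))).
    apply: (presburger_all (R := fun x => x 0 <= x k.+1 -> holds f (scons (x 0) (fun i => x i.+1)))).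
    apply: presburger_imp; first by apply: presburger_le; apply: nlinear_var.
    apply: presburger_ext IHf => x; suff -> : scons (x 0) (fun i => x i.+1) = x by [].
    by apply: functional_extensionality => -[].
  move=> x e eE /=; split=> [h y yx|h y]; last first.
    by apply/(holds_scons f y eE)/h; rewrite -ltnS.
  exact/(@holds_scons _ _ f x e (Ordinal (yx : y < (x k).+1)) eE).
- move=> k T L t b [op [S LE]] bb f IHf.
  have [D eqvP] := presburger_uniform IHf.
  have [J seg] := eqv_segments D.
  exact: (presburger_quantifier eqvP seg IHf _ bb LE).
Qed.

(** * Powers of two *)

(** Beyond [D] the sign of [c + z * m] with [|c| <= D] is that of [z], or of [c] if [z] vanishes. So
    Presburger sets of lengths are ultimately periodic. *)
Lemma eqv_shift D n : D < n ->
  eqv D (fun i => if i is 0 then n else 0) (fun i => if i is 0 then n + D`! else 0).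
Proof.
move=> Dn; split=> [[|i] _|f [a [c [ha hc hf]]]] //; first by rewrite modnDr.
rewrite !hf; case: D ha hc Dn {hf} => [|D] ha hc Dn; first by rewrite !big_ord0.
rewrite !big_ord_recl /= !big1 ?addr0; try by move=> i _; rewrite mulr0.
move: (a 0) (D.+1)`! => {ha} z F.
case: (ltrgt0P z) => z0; last by rewrite z0 !mul0r.
  have pos (m : nat) : n <= m -> (0 <= c + z * m%:Z)%R by nia.
  by rewrite !pos // leq_addr.
have neg (m : nat) : n <= m -> (0 <= c + z * m%:Z)%R = false by nia.
by rewrite !neg // leq_addr.
Qed.

Definition power_of_two (w : seq unit) : Prop := exists j, size w = 2 ^ j.

Lemma not_FO_Grp_power_of_two : ~ FO_Grp power_of_two.
Proof.
move=> [phi phiP]; have [D hD] := presburger_holds phi.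
pose at_ (n : nat) : env := fun i => if i is 0 then n else 0.
have holdsE n : holds phi (at_ n) <-> exists j, n.+1 = 2 ^ j.
  have -> : (exists j, n.+1 = 2 ^ j) <-> power_of_two (ones n.+1).
    by rewrite /power_of_two size_tuple.
  by rewrite phiP; apply: (@holdsP _ _ phi (at_ n) [tuple]) => -[].
pose F := D`!; have F0 : 0 < F := fact_gt0 D.
(* The exponent makes [n] exceed [D] and [2 ^ (D + F)] exceed [F]; shifting by [F] then lands
   strictly between two consecutive powers of two. *)
pose n := (2 ^ (D + F)).-1.
have nE : n.+1 = 2 ^ (D + F) by rewrite prednK // expn_gt0.
have lt2 := ltn_expl (D + F) (ltnSn 1).
have /holdsE : holds phi (at_ n) by apply/holdsE; exists (D + F).
have /hD xx' : eqv D (at_ n) (at_ (n + F)) by apply: eqv_shift; clearbody n F; lia.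
move=> /holdsE/xx'/holdsE[j]; rewrite -addSn nE => jE.
have [le|lt] := leqP j (D + F).
  by have := leq_pexp2l (isT : 0 < 2) le; rewrite -jE; clear -F0; clearbody F; lia.
have := leq_pexp2l (isT : 0 < 2) lt; rewrite -jE expnS; clear -lt2 F0; clearbody F; lia.
Qed.

(** [i] is the leading binary digit of [r]; it lies below [j], so adding [2 ^ j] leaves it
    unchanged. *)
Lemma odd_divn_exp2 r j : 0 < r -> r < 2 ^ j ->
  exists2 i, i < j & odd (r %/ 2 ^ i) /\ odd ((2 ^ j + r) %/ 2 ^ i).
Proof.
move=> r0 rj; have := trunc_log_bounds (isT : 1 < 2) r0; set i := trunc_log 2 r => /andP[ir ri].
have ij : i < j by rewrite -(ltn_exp2l _ _ (isT : 1 < 2)); apply: leq_ltn_trans rj.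
have q1 : r %/ 2 ^ i = 1.
  by apply/eqP; rewrite eqn_leq leq_divRL ?expn_gt0 // mul1n ir andbT -ltnS ltn_divLR ?expn_gt0 // -expnS.
exists i => //; rewrite (divnDl _ (dvdn_exp2l 2 (ltnW ij))) q1; split=> //.
by rewrite -(expnB (isT : 0 < 2) (ltnW ij)) oddD oddX subn_eq0 leqNgt ij.
Qed.

(** A nonzero digit [i] of [N] satisfies [2 ^ i <= N], hence [i < N]: the positions of a word of
    length [N] suffice to index all its digits. *)
Lemma power_of_two_bits N : 0 < N ->
  (exists j, N = 2 ^ j) <->
  exists2 i, i < N & odd (N %/ 2 ^ i) /\ forall j, j < N -> j = i \/ ~ odd (N %/ 2 ^ j).
Proof.
move=> N0; split=> [[j ->]|[i iN [oi ui]]].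
  exists j; first exact: ltn_expl.
  rewrite divnn expn_gt0; split=> // i _; case: (ltngtP i j) => [ij|ji|]; [right|right|by left].
    by rewrite -(expnB (isT : 0 < 2) (ltnW ij)) oddX subn_eq0 leqNgt ij.
  by rewrite divn_small // ltn_exp2l.
have := trunc_log_bounds (isT : 1 < 2) N0; set j := trunc_log 2 N => /andP[jN Nj].
have jlt : j < N by apply: leq_trans jN; apply: ltn_expl.
have oj : odd (N %/ 2 ^ j).
  suff -> : N %/ 2 ^ j = 1 by [].
  by apply/eqP; rewrite eqn_leq leq_divRL ?expn_gt0 // mul1n jN andbT -ltnS ltn_divLR ?expn_gt0 // -expnS.
(* If [N] exceeded its leading power [2 ^ j], the remainder would contribute a second digit
   [l < j]. *)
exists j; apply/eqP; rewrite eqn_leq jN andbT leqNgt; apply/negP => lt.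
have [||l lj [_ ol]] := @odd_divn_exp2 (N - 2 ^ j) j; first by rewrite subn_gt0.
  by rewrite ltn_subLR // addnn -mul2n -expnS.
rewrite subnKC // in ol.
have [ji|] := ui j jlt; last by rewrite oj.
have [li|] := ui l (ltn_trans lj jlt); last by rewrite ol.
by rewrite li -ji ltnn in lj.
Qed.

Lemma FObit_Grp_power_of_two : FObit_Grp power_of_two.
Proof.
(* With positions shifted down by one, [Max] denotes the length [n.+1] in a [Bit] atom and position
   [x] addresses the digit of [2 ^ x]. In the inner scope [Var ord_max] is the outer variable. *)
exists (Ex (And (Bit unit Grp isT (Var ord0) (Max 1))
  (All (Or (Eq unit true Grp (Var ord0) (Var ord_max))
           (Not (Bit unit Grp isT (Var ord0) (Max 2))))))) => n w.
rewrite /power_of_two (size_tuple w) power_of_two_bits //= /BIT /=.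
have e0 k (x : 'I_n.+1) (e : k.-tuple 'I_n.+1) : tnth [tuple of x :: e] ord0 = x.
  by rewrite (tnth_nth x).
have e1 (x y : 'I_n.+1) : tnth [tuple of y :: [tuple of x :: [tuple]]] ord_max = x.
  by rewrite (tnth_nth x).
split=> [[i iN [oi ui]]|[x [ox ux]]].
  exists (Ordinal iN); rewrite e0; split=> // y; rewrite e1 !e0.
  by case: (ui y (ltn_ord y)) => [yi|]; [left; apply: val_inj|right].
rewrite e0 in ox; exists x => //; split=> // j jN.
have := ux (Ordinal (jN : j < n.+1)); rewrite e1 !e0 /= => -[/(congr1 val)|]; by [left|right].
Qed.

Theorem theorem26 : ~ contained FObit_Grp FO_Grp.
Proof.
by move=> sub; apply: not_FO_Grp_power_of_two; apply: sub FObit_Grp_power_of_two.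
Qed.
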